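(* Let $n,p$ be positive integers, $k\in\{1,\dots,p\}$, $\gamma>0$, $X\in\mathbb{R}^{n\times p}$ with columns $X_1,\dots,X_p\in\mathbb{R}^n$, and $Y\in\mathbb{R}^n$. Then the sparse regression problem $$\min_{w\in\mathbb{R}^p}\ \Big\{\tfrac{1}{2\gamma}\|w\|_2^2+\tfrac12\|Y-Xw\|_2^2 \ :\ \|w\|_0\le k\Big\}$$ can be reformulated as the binary nonlinear optimization problem $$\min_{s\in S^p_k}\ \tfrac12\, Y^\top\Big(I_n+\gamma\sum_{j=1}^p s_jK_j\Big)^{-1}Y,$$ where $K_j:=X_jX_j^\top$ is an $n\times n$ positive semidefinite matrix for every $j$; that is, the two problems have the same optimal value.
   Context: $\|w\|_0$ denotes the number of nonzero entries of $w$. $S^p_k:=\{s\in\{0,1\}^p : \sum_{j=1}^p s_j\le k\}$. $I_n$ is the $n\times n$ identity matrix. *)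

(* Defs.v *)
From mathcomp Require Export all_boot all_order all_algebra.
From mathcomp Require Export boolp classical_sets reals.

Set Implicit Arguments.
Unset Strict Implicit.
Unset Printing Implicit Defensive.

Import Order.TTheory GRing.Theory Num.Theory.
Local Open Scope classical_set_scope.
Local Open Scope ring_scope.

(* The Euclidean norm; the library's normed structure on matrices is the
   sup norm. *)
Definition l2norm (R : realType) (m : nat) (u : 'cV[R]_m) : R :=
  Num.sqrt (\sum_i u i 0 ^+ 2).

Definition l0norm (R : realType) (m : nat) (u : 'cV[R]_m) : nat :=
  #|[set i | u i 0 != 0]%SET|.

Definition sparse_binary (R : realType) (p k : nat) : set 'cV[R]_p :=
  [set s | (forall j, s j 0 = 0 \/ s j 0 = 1) /\ \sum_j s j 0 <= k%:R].

Definition possemidef (R : realType) (m : nat) (A : 'M[R]_m) : Prop :=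
  A^T = A /\ forall u : 'cV[R]_m, 0 <= (u^T *m A *m u) 0 0.

(* [v] is the optimal value of min { f x : x in D }; the minimum is required
   to be attained, and [v] is then unique. *)
Definition is_min_value (R : realType) (T : Type) (D : set T) (f : T -> R)
    (v : R) : Prop :=
  (f @` D) v /\ lbound (f @` D) v.

Definition gram_col (R : realType) (n p : nat) (X : 'M[R]_(n, p)) (j : 'I_p) :
    'M[R]_n :=
  col j X *m (col j X)^T.

Definition kernel_mx (R : realType) (n p : nat) (gamma : R)
    (X : 'M[R]_(n, p)) (s : 'cV[R]_p) : 'M[R]_n :=
  1%:M + gamma *: \sum_j s j 0 *: gram_col X j.

Definition sparse_obj (R : realType) (n p : nat) (gamma : R)
    (X : 'M[R]_(n, p)) (Y : 'cV[R]_n) (w : 'cV[R]_p) : R :=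
  (2 * gamma)^-1 * l2norm w ^+ 2 + 2^-1 * l2norm (Y - X *m w) ^+ 2.

Definition binary_obj (R : realType) (n p : nat) (gamma : R)
    (X : 'M[R]_(n, p)) (Y : 'cV[R]_n) (s : 'cV[R]_p) : R :=
  2^-1 * (Y^T *m invmx (kernel_mx gamma X s) *m Y) 0 0.

(* Main.v *)
Require Import Defs.
From mathcomp Require Import ring.

Set Implicit Arguments.
Unset Strict Implicit.
Unset Printing Implicit Defensive.

Import Order.TTheory GRing.Theory Num.Theory.
Local Open Scope classical_set_scope.
Local Open Scope ring_scope.

(** Fix a binary vector [s], put [D = diag s] and restrict the regression to
    the vectors supported on [s], that is, to those with [D w = w].  The kernel
    matrix is [K = I + gamma X D X^T], and [D] is a symmetric idempotent, so
    [u^T K u = |u|^2 + gamma |D X^T u|^2]; hence [K] is invertible.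

    Let [u = K^-1 Y].  The restricted problem is a ridge regression, and its
    solution is [w0 = gamma D X^T u], whose residual [Y - X w0] is [u] itself.
    The linear terms cancel when the objective is expanded around [w0], so
    for every [w] supported on [s]
      [obj_Y w = Y^T K^-1 Y / 2 + obj_0 (w - w0)],
    where [obj_0 >= 0] is the objective for the zero response
    ([sparse_obj_supported]).  As [w0] is itself supported on [s] and
    [obj_0 0 = 0], the value of [s] in the binary
    problem is the minimum of the regression over the vectors supported on [s].

    The vectors with at most [k] nonzero entries are exactly those supported on
    some [s] with at most [k] ones, so minimizing over [s] as well gives the
    equality of the two values.  The binary problem has finitely many feasible
    points, which is why a minimizer exists on both sides. *)

(** * The Euclidean inner product *)

Definition dot (R : realType) (m : nat) (u v : 'cV[R]_m) : R :=
  (u^T *m v) 0 0.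

Section Dot.
Context {R : realType}.

Lemma dotE m (u v : 'cV[R]_m) : dot u v = \sum_i u i 0 * v i 0.
Proof. by rewrite /dot mxE; apply: eq_bigr => i _; rewrite mxE. Qed.

Lemma dotC m (u v : 'cV[R]_m) : dot u v = dot v u.
Proof. by rewrite !dotE; apply: eq_bigr => i _; rewrite mulrC. Qed.

Lemma dotDr m (u v w : 'cV[R]_m) : dot u (v + w) = dot u v + dot u w.
Proof. by rewrite /dot mulmxDr mxE. Qed.

Lemma dotZr m a (u v : 'cV[R]_m) : dot u (a *: v) = a * dot u v.
Proof. by rewrite /dot -scalemxAr mxE. Qed.

Lemma dotDl m (u v w : 'cV[R]_m) : dot (v + w) u = dot v u + dot w u.
Proof. by rewrite !(dotC _ u) dotDr. Qed.

Lemma dotZl m a (u v : 'cV[R]_m) : dot (a *: v) u = a * dot v u.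
Proof. by rewrite !(dotC _ u) dotZr. Qed.

Lemma dotMl m q (A : 'M[R]_(m, q)) u v : dot (A *m u) v = dot u (A^T *m v).
Proof. by rewrite /dot trmx_mul mulmxA. Qed.

Lemma dot_sqr_ge0 m (u : 'cV[R]_m) : 0 <= dot u u.
Proof. by rewrite dotE sumr_ge0 // => i _; rewrite -expr2 sqr_ge0. Qed.

Lemma dot_sqr_eq0 m (u : 'cV[R]_m) : dot u u = 0 -> u = 0.
Proof.
rewrite dotE => /eqP; rewrite psumr_eq0 => [/allP u0|i _]; last first.
  by rewrite -expr2 sqr_ge0.
apply/colP => i; rewrite mxE; apply/eqP.
by have := u0 i (mem_index_enum i); rewrite mulf_eq0 orbb.
Qed.

Lemma l2norm_sqr m (u : 'cV[R]_m) : l2norm u ^+ 2 = dot u u.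
Proof.
rewrite /l2norm sqr_sqrtr; last by rewrite sumr_ge0 // => i _; rewrite sqr_ge0.
by rewrite dotE; apply: eq_bigr => i _; rewrite expr2.
Qed.

End Dot.

(** * The kernel matrix *)

Section Kernel.
Context {R : realType} {n p : nat}.
Context (gamma : R) (X : 'M[R]_(n, p)).
Implicit Types (s w : 'cV[R]_p) (Y u : 'cV[R]_n).

Definition binary s := forall j, s j 0 = 0 \/ s j 0 = 1.

Lemma gram_col_psd j : possemidef (gram_col X j).
Proof.
split; first by rewrite /gram_col trmx_mul trmxK.
move=> u; have -> : (u^T *m gram_col X j *m u) 0 0
    = dot ((col j X)^T *m u) ((col j X)^T *m u).
  by rewrite /dot /gram_col trmx_mul trmxK !mulmxA.
exact: dot_sqr_ge0.
Qed.

Lemma kernel_mxE s :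
  kernel_mx gamma X s = 1%:M + gamma *: (X *m diag_mx s^T *m X^T).
Proof.
congr (_ + _ *: _); apply/matrixP => i l.
rewrite summxE [RHS]mxE; apply: eq_bigr => j _.
rewrite mul_mx_diag !mxE big_ord1 !mxE; ring.
Qed.

Lemma tr_kernel_mx s : (kernel_mx gamma X s)^T = kernel_mx gamma X s.
Proof.
by rewrite kernel_mxE linearD linearZ /= tr_scalar_mx !trmx_mul trmxK
  tr_diag_mx mulmxA.
Qed.

Lemma diag_binary_idem s :
  binary s -> diag_mx s^T *m diag_mx s^T = diag_mx s^T.
Proof.
move=> sB; rewrite mulmx_diag; congr diag_mx; apply/rowP => j.
by rewrite !mxE; case: (sB j) => ->; rewrite ?mulr0 ?mulr1.
Qed.

(** Since [D] is idempotent, the form [v^T D v] is the squared norm of [D v];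
    this puts positivity, and hence the invertibility of [K], in plain sight. *)
Lemma kernel_quadratic s u : binary s ->
  dot u (kernel_mx gamma X s *m u) =
  dot u u + gamma * dot (diag_mx s^T *m (X^T *m u)) (diag_mx s^T *m (X^T *m u)).
Proof.
move=> sB; rewrite dotMl tr_diag_mx !mulmxA diag_binary_idem //.
rewrite dotMl trmxK kernel_mxE mulmxDl mul1mx dotDr -scalemxAl dotZr.
by rewrite !mulmxA.
Qed.

Lemma kernel_mx_unit s :
  0 < gamma -> binary s -> kernel_mx gamma X s \in unitmx.
Proof.
move=> g_gt0 sB; rewrite -row_free_unit; apply: inj_row_free => v vK0.
suff v0 : v^T = 0 by rewrite -[v]trmxK v0 trmx0.
have Kv0 : kernel_mx gamma X s *m v^T = 0.
  by rewrite -[kernel_mx _ _ _]tr_kernel_mx -trmx_mul vK0 trmx0.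
apply/dot_sqr_eq0/eqP; rewrite eq_le dot_sqr_ge0 andbT.
have := kernel_quadratic v^T sB; rewrite Kv0 {1}/dot mulmx0 mxE => ->.
by rewrite lerDl mulr_ge0 ?dot_sqr_ge0 // ltW.
Qed.

(** * The regression restricted to a support *)

Lemma sparse_objE Y w :
  sparse_obj gamma X Y w =
  (2 * gamma)^-1 * dot w w + 2^-1 * dot (Y - X *m w) (Y - X *m w).
Proof. by rewrite /sparse_obj !l2norm_sqr. Qed.

Lemma sparse_obj_ge0 Y w : 0 < gamma -> 0 <= sparse_obj gamma X Y w.
Proof.
move=> g_gt0; rewrite sparse_objE.
by rewrite addr_ge0 // mulr_ge0 ?dot_sqr_ge0 ?invr_ge0 // mulr_ge0 // ltW.
Qed.

Lemma sparse_obj00 : sparse_obj gamma X 0 0 = 0.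
Proof. by rewrite sparse_objE mulmx0 subr0 /dot !mulmx0 !mxE !mulr0 addr0. Qed.

Definition supported_on s w := diag_mx s^T *m w = w.

Definition ridge_solution s Y : 'cV[R]_p :=
  gamma *: (diag_mx s^T *m (X^T *m (invmx (kernel_mx gamma X s) *m Y))).

Lemma ridge_solution_supported s Y :
  binary s -> supported_on s (ridge_solution s Y).
Proof.
move=> sB; rewrite /supported_on /ridge_solution -scalemxAr.
by rewrite (mulmxA (diag_mx _) (diag_mx _)) diag_binary_idem.
Qed.

Lemma ridge_residual s Y : kernel_mx gamma X s \in unitmx ->
  Y - X *m ridge_solution s Y = invmx (kernel_mx gamma X s) *m Y.
Proof.
move=> Ku; rewrite /ridge_solution; set u := invmx _ *m Y.
have {1}-> : Y = kernel_mx gamma X s *m u by rewrite /u mulKVmx.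
by rewrite kernel_mxE mulmxDl mul1mx -scalemxAl -scalemxAr !mulmxA addrK.
Qed.

(** Completing the square around the ridge solution [gamma t], whose residual
    is [u].  The cross terms are [t . d] from the penalty and [- u . X d] from
    the fit; they cancel because [d] is supported on [s], which gives
    [u . X d = X^T u . D d = t . d].  The constant term
    [gamma |t|^2 + |u|^2 = u . K u] is [Y . K^-1 Y]. *)
Lemma sparse_obj_supported s Y w :
  0 < gamma -> binary s -> supported_on s w ->
  sparse_obj gamma X Y w =
  binary_obj gamma X Y s + sparse_obj gamma X 0 (w - ridge_solution s Y).
Proof.
move=> g_gt0 sB ws; have Ku := kernel_mx_unit g_gt0 sB.
have := ridge_residual Y Ku.
have := ridge_solution_supported Y sB.
rewrite /ridge_solution; set u := invmx _ *m Y; set t := diag_mx _ *m _.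
move=> w0s res; set d := w - _.
have ds : diag_mx s^T *m d = d by rewrite /d mulmxBr ws w0s.
have wE : w = gamma *: t + d by rewrite /d addrC subrK.
have cross : dot u (X *m d) = dot t d.
  by rewrite -[in LHS]ds /t !dotMl tr_diag_mx trmxK.
have bin : binary_obj gamma X Y s = 2^-1 * (dot u u + gamma * dot t t).
  rewrite -kernel_quadratic // /u mulKVmx // dotC /dot /binary_obj.
  by rewrite mulmxA.
have resw : Y - X *m w = u + (-1) *: (X *m d).
  by rewrite wE mulmxDr opprD addrA res scaleN1r.
have res0 : 0 - X *m d = (-1) *: (X *m d) by rewrite sub0r scaleN1r.
clearbody d t u.
rewrite bin !sparse_objE resw res0 wE !(dotDl, dotDr, dotZl, dotZr).
rewrite (dotC d t) (dotC (X *m d) u) cross.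
by field; rewrite gt_eqF.
Qed.

Lemma binary_obj_le s Y w : 0 < gamma -> binary s -> supported_on s w ->
  binary_obj gamma X Y s <= sparse_obj gamma X Y w.
Proof.
by move=> g0 sB ws; rewrite (sparse_obj_supported _ g0 sB ws) lerDl
  sparse_obj_ge0.
Qed.

Lemma sparse_obj_ridge s Y : 0 < gamma -> binary s ->
  sparse_obj gamma X Y (ridge_solution s Y) = binary_obj gamma X Y s.
Proof.
move=> g0 sB; have ws := ridge_solution_supported Y sB.
by rewrite (sparse_obj_supported _ g0 sB ws) subrr sparse_obj00 addr0.
Qed.

End Kernel.

(** * Binary vectors as supports *)

Section Support.
Context {R : realType} {p : nat}.
Implicit Types (s w : 'cV[R]_p) (A : {set 'I_p}).

Definition supp w : {set 'I_p} := [set j | w j 0 != 0]%SET.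

Definition indicator A : 'cV[R]_p := \col_j (j \in A)%:R.

Lemma indicator_binary A : binary (indicator A).
Proof. by move=> j; rewrite mxE; case: (j \in A); [right|left]. Qed.

Lemma supp_indicator A : supp (indicator A) = A.
Proof. by apply/setP => j; rewrite inE mxE pnatr_eq0 eqb0 negbK. Qed.

Lemma indicator_supp s : binary s -> indicator (supp s) = s.
Proof.
move=> sB; apply/colP => j; rewrite mxE inE.
by case: (sB j) => ->; rewrite ?eqxx ?oner_eq0.
Qed.

Lemma sum_indicator A : \sum_j indicator A j 0 = #|A|%:R.
Proof.
rewrite (eq_bigr (fun j => (j \in A)%:R)) => [|j _]; last by rewrite mxE.
by rewrite -natr_sum -big_mkcond /= sum1_card.
Qed.

Lemma sparse_binaryP k s :
  sparse_binary k s <-> binary s /\ (#|supp s| <= k)%N.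
Proof.
have card_sum : binary s -> \sum_j s j 0 = #|supp s|%:R.
  by move=> sB; rewrite -sum_indicator indicator_supp.
by split=> -[sB sk]; split=> //; move: sk; rewrite card_sum ?ler_nat.
Qed.

Lemma supported_onP s w :
  binary s -> supported_on s w <-> supp w \subset supp s.
Proof.
move=> sB; have coord j : (diag_mx s^T *m w) j 0 = s j 0 * w j 0.
  by rewrite mul_diag_mx !mxE.
split=> [ws|/fintype.subsetP ws].
  apply/fintype.subsetP => j; rewrite !inE -{1}ws coord mulf_eq0 negb_or.
  by case/andP.
apply/colP => j; rewrite coord.
have [->|wj] := eqVneq (w j 0) 0; first by rewrite mulr0.
have := ws j; rewrite !inE => /(_ wj).
by case: (sB j) => -> //; rewrite ?eqxx // mul1r.
Qed.

(** There are finitely many binary vectors, one for each subset of the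
    coordinates, so every function has a minimum over the sparse ones. *)
Lemma sparse_binary_min k (f : 'cV[R]_p -> R) :
  exists2 s, sparse_binary k s & forall s', sparse_binary k s' -> f s <= f s'.
Proof.
pose small A := (#|A| <= k)%N.
have small0 : small finset.set0 by rewrite /small cards0.
case: (arg_minP (fun A => f (indicator A)) small0) => A Ak minA.
exists (indicator A).
  apply/sparse_binaryP; split; first exact: indicator_binary.
  by rewrite supp_indicator.
move=> s' /sparse_binaryP[s'B s'k].
by rewrite -(indicator_supp s'B); apply: minA.
Qed.

End Support.

Theorem theorem1 (R : realType) (n p k : nat) (gamma : R)
    (X : 'M[R]_(n, p)) (Y : 'cV[R]_n)
    (hn : (0 < n)%N) (hp : (0 < p)%N) (hk : (1 <= k <= p)%N)
    (hgamma : 0 < gamma) :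
  [/\ forall j : 'I_p, possemidef (gram_col X j),
      forall s : 'cV[R]_p, sparse_binary k s -> kernel_mx gamma X s \in unitmx
    & exists v : R,
        is_min_value [set w : 'cV[R]_p | (l0norm w <= k)%N]
                     (sparse_obj gamma X Y) v /\
        is_min_value (sparse_binary k : set 'cV[R]_p)
                     (binary_obj gamma X Y) v].
Proof.
split; first exact: gram_col_psd.
  by move=> s /sparse_binaryP[sB _]; apply: kernel_mx_unit.
have [s sk s_min] := sparse_binary_min k (binary_obj gamma X Y).
exists (binary_obj gamma X Y s); split; last first.
  by split; [exists s | move=> _ [s' s'k <-]; apply: s_min].
have /sparse_binaryP[sB sc] := sk; split.
  exists (ridge_solution gamma X s Y); last exact: sparse_obj_ridge.
  apply: leq_trans sc; apply/subset_leq_card/supported_onP => //.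
  exact: ridge_solution_supported.
move=> _ [w wk <-].
pose s' : 'cV[R]_p := indicator (supp w).
have s'B : binary s' by apply: indicator_binary.
apply: (le_trans (s_min s' _)).
  by apply/sparse_binaryP; rewrite supp_indicator.
apply: binary_obj_le => //.
by apply/supported_onP; rewrite ?supp_indicator.
Qed.
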